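(* Let $\mathcal{V}$ be a semidegenerate congruence-modular variety and let $A\in\mathcal{V}$ be semiprime. Then the function $\lambda_A|_{B(Con(A))}:B(Con(A))\rightarrow B(L(A))$ is a Boolean isomorphism.
   Context: Algebras have a fixed finite signature $\tau$. A variety is semidegenerate if none of its nontrivial algebras has a one-element subalgebra. For $A$ in a semidegenerate congruence-modular variety $\mathcal{V}$, $Con(A)$ is the congruence lattice with least element $\Delta_A$ and greatest element $\nabla_A$; $K(A)$ is the set of compact (= finitely generated) congruences (here $\nabla_A\in K(A)$). $[\cdot,\cdot]$ is the modular commutator of Freese–McKenzie: the greatest operation on congruence lattices of members of $\mathcal{V}$ such that for every surjective morphism $f:A\to B$ and $\alpha,\beta\in Con(A)$, $[\alpha,\beta]_A\subseteq\alpha\cap\beta$ and $[\alpha,\beta]_A\lor Ker(f)=f^{-1}([f(\alpha\lor Ker(f)),f(\beta\lor Ker(f))]_B)$. It is commutative, monotone, distributes over arbitrary joins, and satisfies $[\theta,\nabla_A]=\theta$. A congruence $\phi\neq\nabla_A$ is prime if $[\alpha,\beta]\subseteq\phi$ implies $\alpha\subseteq\phi$ or $\beta\subseteq\phi$, for all $\alpha,\beta\in Con(A)$. $Spec(A)$ is the set of prime congruences. The radical is $\rho(\theta)=\bigwedge\{\phi\in Spec(A)\mid\theta\subseteq\phi\}$. $A$ is semiprime if $\rho(\Delta_A)=\Delta_A$. $C(A)$ is the smallest subset of $Con(A)$ containing $K(A)$ and closed under binary joins and commutators. For $\alpha,\beta\in C(A)$ put $\alpha\equiv\beta$ iff $\rho(\alpha)=\rho(\beta)$.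 $L(A)=C(A)/{\equiv}$ is a bounded distributive lattice with join induced by $\lor$, meet induced by $[\cdot,\cdot]$, $0$ = class of $\Delta_A$, $1$ = class of $\nabla_A$; $\lambda_A:C(A)\to L(A)$ is the quotient map. $B(Con(A))$ is the Boolean algebra of complemented elements of the lattice $Con(A)$; it is contained in $K(A)\subseteq C(A)$. $B(L)$ denotes the Boolean algebra of complemented elements of a bounded distributive lattice $L$. The map $\lambda_A$ sends $B(Con(A))$ into $B(L(A))$. *)

(* Defs.v *)
From HB Require Import structures.
From mathcomp Require Import all_boot all_order.
From mathcomp Require Import boolp classical_sets functions cardinality.

Set Implicit Arguments.
Unset Strict Implicit.
Unset Printing Implicit Defensive.

Import Order.Theory.
Local Open Scope classical_set_scope.
Local Open Scope order_scope.

Record signature := Signature { symb : finType; arity : symb -> nat }.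

Record algebra (tau : signature) := Algebra {
  carrier :> Type;
  interp : forall s : symb tau, ('I_(arity s) -> carrier) -> carrier;
  carrier_inhabited : inhabited carrier }.
Arguments interp {tau} a s _.

Record hom (tau : signature) (A B : algebra tau) := Hom {
  hom_fun :> A -> B;
  homP : forall s (x : 'I_(arity s) -> A),
    hom_fun (interp A s x) = interp B s (fun i => hom_fun (x i)) }.

Definition surjective T U (f : T -> U) := forall y, exists x, f x = y.

Lemma prod_inhabited (tau : signature) (I : Type) (F : I -> algebra tau) :
  inhabited (forall i, F i).
Proof.
have H i : exists x : F i, True by case: (carrier_inhabited (F i)) => x; exists x.
exact: inhabits (fun i => projT1 (cid (H i))).
Qed.

Definition prod_algebra (tau : signature) (I : Type) (F : I -> algebra tau) :=
  @Algebra tau (forall i, F i) (fun s x i => interp (F i) s (fun j => x j i))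
    (prod_inhabited F).

(* Subalgebras are taken up to isomorphism: they are the domains of the
   injective morphisms. *)
Record variety (tau : signature) := Variety {
  vmem :> algebra tau -> Prop;
  variety_H : forall (A B : algebra tau) (f : hom A B),
    surjective f -> vmem A -> vmem B;
  variety_S : forall (A B : algebra tau) (f : hom B A),
    injective f -> vmem A -> vmem B;
  variety_P : forall (I : Type) (F : I -> algebra tau),
    (forall i, vmem (F i)) -> vmem (prod_algebra F) }.

Definition subuniverse (tau : signature) (A : algebra tau) (S : set A) :=
  forall s (x : 'I_(arity s) -> A), (forall i, S (x i)) -> S (interp A s x).

Definition nontrivial (tau : signature) (A : algebra tau) :=
  exists x y : A, x <> y.

(* A one-element subalgebra is a singleton subuniverse. *)
Definition semidegenerate (tau : signature) (V : variety tau) :=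
  forall A, V A -> nontrivial A -> ~ exists a : A, subuniverse [set a].

Record con (tau : signature) (A : algebra tau) := Congruence {
  con_rel :> A -> A -> Prop;
  con_refl : forall x, con_rel x x;
  con_sym : forall x y, con_rel x y -> con_rel y x;
  con_trans : forall y x z, con_rel x y -> con_rel y z -> con_rel x z;
  con_compat : forall s (x y : 'I_(arity s) -> A),
    (forall i, con_rel (x i) (y i)) ->
    con_rel (interp A s x) (interp A s y) }.

HB.instance Definition _ tau (A : algebra tau) := gen_eqMixin (con A).
HB.instance Definition _ tau (A : algebra tau) := gen_choiceMixin (con A).

Fact con_display : Order.disp_t. Proof. exact: (Order.Disp tt tt). Qed.

Section CongruenceLattice.
Variables (tau : signature) (A : algebra tau).
Implicit Types (a b c : con A).

Lemma con_ext a b : (forall x y, a x y <-> b x y) -> a = b.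
Proof.
case: a => [r1 p1 p2 p3 p4]; case: b => [r2 q1 q2 q3 q4] /= E.
have {}E : r1 = r2 by apply/funext => x; apply/funext => y; apply/propext.
by case: _ / E in q1 q2 q3 q4 *; congr Congruence; apply: Prop_irrelevance.
Qed.

Definition con_inf (S : set (con A)) : con A.
Proof.
exists (fun x y => forall a, S a -> a x y).
- by move=> x a _; apply: con_refl.
- by move=> x y H a Sa; apply/con_sym/H.
- by move=> y x z H1 H2 a Sa; apply: (con_trans (H1 a Sa) (H2 a Sa)).
- by move=> s x y H a Sa; apply: con_compat => i; apply: H.
Defined.

Definition cg (R : set (A * A)) : con A :=
  con_inf [set a : con A | forall x y, R (x, y) -> a x y].

Definition con_sup (S : set (con A)) : con A :=
  cg [set p | exists2 a : con A, S a & a p.1 p.2].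

Definition con_bot : con A.
Proof.
exists eq => // [y x z -> -> //|s x y H].
by congr interp; apply/funext.
Defined.

Definition con_top : con A.
Proof. by exists (fun _ _ => True). Defined.

Definition con_meet a b : con A := con_inf [set a; b].
Definition con_join a b : con A := con_sup [set a; b].
Definition con_le a b := `[< forall x y, a x y -> b x y >].

Lemma con_le_refl : reflexive con_le.
Proof. by move=> a; apply/asboolP. Qed.

Lemma con_le_anti : antisymmetric con_le.
Proof.
by move=> a b /andP[/asboolP ab /asboolP ba]; apply: con_ext => x y; split;
  [apply: ab|apply: ba].
Qed.

Lemma con_le_trans : transitive con_le.
Proof.
by move=> b a c /asboolP ab /asboolP bc; apply/asboolP => x y /ab /bc.
Qed.

HB.instance Definition _ := Order.Le_isPOrder.Build con_display (con A)
  con_le_refl con_le_anti con_le_trans.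

Lemma conleP a b : reflect (forall x y, a x y -> b x y) (a <= b).
Proof. exact: asboolP. Qed.

Lemma cg_sub (R : set (A * A)) x y : R (x, y) -> cg R x y.
Proof. by move=> Rxy a; apply. Qed.

Lemma cg_le (R : set (A * A)) a :
  (forall x y, R (x, y) -> a x y) -> cg R <= a.
Proof. by move=> H; apply/conleP => x y; apply. Qed.

Lemma con_sup_ub (S : set (con A)) a : S a -> a <= con_sup S.
Proof. by move=> Sa; apply/conleP => x y axy; apply: cg_sub; exists a. Qed.

Lemma con_sup_le (S : set (con A)) b :
  (forall a, S a -> a <= b) -> con_sup S <= b.
Proof.
by move=> H; apply: cg_le => x y [a Sa /=]; move: x y; apply/conleP/H.
Qed.

Lemma con_meetP a b c : (a <= con_meet b c) = (a <= b) && (a <= c).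
Proof.
apply/idP/andP => [/conleP H|[/conleP H1 /conleP H2]].
  by split; apply/conleP => x y /H; apply; [left|right].
by apply/conleP => x y axy d [->|->]; [apply: H1|apply: H2].
Qed.

Lemma con_joinP a b c : (con_join a b <= c) = (a <= c) && (b <= c).
Proof.
apply/idP/andP => [H|[H1 H2]]; last by apply: con_sup_le => d [->|->].
by split; apply: le_trans H; apply: con_sup_ub; [left|right].
Qed.

HB.instance Definition _ :=
  Order.POrder_MeetJoin_isLattice.Build con_display (con A) con_meetP con_joinP.

Lemma con_bot_le a : con_bot <= a.
Proof. by apply/conleP => x y ->; apply: con_refl. Qed.

Lemma con_top_le a : a <= con_top.
Proof. by apply/conleP. Qed.

HB.instance Definition _ :=
  Order.hasBottom.Build con_display (con A) con_bot_le.
HB.instance Definition _ := Order.hasTop.Build con_display (con A) con_top_le.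

(* These are the compact elements of the lattice con A. *)
Definition finitely_generated : set (con A) :=
  [set a | exists2 R : set (A * A), finite_set R & a = cg R].

End CongruenceLattice.

Definition congruence_modular (tau : signature) (V : variety tau) :=
  forall A, V A -> forall a b c : con A, a <= c ->
    a `|` (b `&` c) = (a `|` b) `&` c.

Section Transport.
Variables (tau : signature) (A B : algebra tau) (f : hom A B).

Definition con_preim (b : con B) : con A.
Proof.
exists (fun x y => b (f x) (f y)).
- by move=> x; apply: con_refl.
- by move=> x y; apply: con_sym.
- by move=> y x z; apply: con_trans.
- by move=> s x y H; rewrite !homP; apply: con_compat.
Defined.

Definition con_ker : con A := con_preim \bot.

(* The congruence f(a `|` ker f) of B: the joined kernel makes the direct image
   transitive. *)
Definition con_img (fS : surjective f) (a : con A) : con B.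
Proof.
exists (fun u v => exists x y, [/\ f x = u, f y = v & (a `|` con_ker) x y]).
- by move=> u; have [x <-] := fS u; exists x, x; split=> //; apply: con_refl.
- by move=> u v [x [y [<- <- axy]]]; exists y, x; split=> //; apply: con_sym.
- move=> v u w [x [y [<- <- axy]]] [y' [z [E <- ayz]]]; exists x, z; split=> //.
  apply: (con_trans axy); apply: con_trans ayz.
  suff /conleP : con_ker <= a `|` con_ker by apply; symmetry.
  exact: leUr.
- move=> s u v H.
  have [x Hx] := fin_all_exists H.
  have [y Hy] := fin_all_exists Hx.
  exists (interp A s x), (interp A s y); split.
  + by rewrite homP; congr interp; apply/funext => i; have [] := Hy i.
  + by rewrite homP; congr interp; apply/funext => i; have [] := Hy i.
  + by apply: con_compat => i; have [] := Hy i.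
Defined.

Lemma le_con_preim b1 b2 : b1 <= b2 -> con_preim b1 <= con_preim b2.
Proof. by move=> /conleP H; apply/conleP => x y; apply: H. Qed.

Lemma ker_le_preim b : con_ker <= con_preim b.
Proof. by apply/le_con_preim/le0x. Qed.

End Transport.

Definition operation (tau : signature) :=
  forall A : algebra tau, con A -> con A -> con A.

(* B need not be assumed to be in V: it is a homomorphic image of A. *)
Definition commutator_laws (tau : signature) (V : variety tau)
    (C : operation tau) :=
  forall A : algebra tau, V A ->
    (forall a b : con A, C A a b <= a `&` b) /\
    (forall (B : algebra tau) (f : hom A B) (fS : surjective f) (a b : con A),
       C A a b `|` con_ker f =
       con_preim f (C B (con_img fS a) (con_img fS b))).

(* The pointwise supremum of all the operations obeying the laws; it obeys them
   as well, see commutator_greatest. *)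
Definition commutator (tau : signature) (V : variety tau) : operation tau :=
  fun A a b => con_sup [set c | exists2 C, commutator_laws V C & c = C A a b].

Lemma commutator_laws_bot (tau : signature) (V : variety tau) :
  commutator_laws V (fun A _ _ => \bot).
Proof.
by move=> A VA; split=> [a b|B f fS a b]; [rewrite le0x|rewrite join0x].
Qed.

Lemma commutator_le (tau : signature) (V : variety tau) (A : algebra tau) :
  V A -> forall a b : con A, commutator V a b <= a `&` b.
Proof.
by move=> VA a b; apply: con_sup_le => c [C HC ->]; apply: (HC A VA).1.
Qed.

Lemma commutator_greatest (tau : signature) (V : variety tau) :
  commutator_laws V (commutator V) /\
  forall C, commutator_laws V C ->
    forall A, V A -> forall a b : con A, C A a b <= commutator V a b.
Proof.
split; last by move=> C HC A VA a b; apply: con_sup_ub; exists C.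
move=> A VA; split=> [|B f fS a b]; first exact: commutator_le.
apply: le_anti; apply/andP; split.
  rewrite leUx ker_le_preim andbT; apply: con_sup_le => c [C HC ->].
  apply: (@le_trans _ _ (C A a b `|` con_ker f)); first exact: leUl.
  rewrite (HC A VA).2; apply: le_con_preim.
  by apply: con_sup_ub; exists C.
set g := commutator V a b `|` con_ker f.
have /conleP H : commutator V (con_img fS a) (con_img fS b) <= con_img fS g.
  apply: con_sup_le => c [C HC ->]; apply/conleP => u v.
  have [x <-] := fS u; have [y <-] := fS v.
  move=> Hxy; exists x, y; split=> //.
  have : con_preim f (C B (con_img fS a) (con_img fS b)) <= g `|` con_ker f.
    rewrite -(HC A VA).2 -joinA joinxx leU2 //.
    by apply: con_sup_ub; exists C.
  by move/conleP; apply.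
apply/conleP => x y /H [x' [y' [Ex Ey]]].
rewrite -joinA joinxx => Hg.
have /conleP Hk : con_ker f <= g by exact: leUr.
apply: (con_trans (Hk _ _ _)); last apply: (con_trans Hg (Hk _ _ _)) => //=.
by symmetry.
Qed.

Record sdcm_variety (tau : signature) := SdcmVariety {
  sdcm_class :> variety tau;
  sdcm_semidegenerate : semidegenerate sdcm_class;
  sdcm_modular : congruence_modular sdcm_class }.

Record member (tau : signature) (V : variety tau) := Member {
  member_algebra :> algebra tau;
  memberP : V member_algebra }.

Section Radical.
Variables (tau : signature) (V : variety tau) (A : member V).

Definition comm (a b : con A) : con A := commutator V a b.

Definition prime_congruence (p : con A) :=
  p <> \top /\ forall a b : con A, comm a b <= p -> a <= p \/ b <= p.

Definition Spec : set (con A) := [set p | prime_congruence p].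

Definition radical (a : con A) : con A := con_inf [set p | Spec p /\ a <= p].

Definition semiprime := radical \bot = \bot.

Inductive Cset : set (con A) :=
  | Cset_fg a of finitely_generated a : Cset a
  | Cset_join a b of Cset a & Cset b : Cset (a `|` b)
  | Cset_comm a b of Cset a & Cset b : Cset (comm a b).

Lemma comm_le a b : comm a b <= a `&` b.
Proof. exact/commutator_le/memberP. Qed.

Lemma prime_commE p a b : Spec p -> (comm a b <= p) = (a <= p) || (b <= p).
Proof.
case=> _ Pp; apply/idP/orP => [/Pp //|H]; apply: le_trans (comm_le a b) _.
by case: H => H; [apply: leIxl|apply: leIxr].
Qed.

Lemma radical_ub a p : Spec p -> (radical a <= p) = (a <= p).
Proof.
move=> Pp; apply/idP/idP => H.
  apply: le_trans H; apply/conleP => x y axy q [_ /conleP aq]; exact: aq.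
by apply/conleP => x y; apply.
Qed.

Lemma radicalP a b :
  radical a = radical b <-> forall p, Spec p -> (a <= p) = (b <= p).
Proof.
split=> [E p Pp|E]; first by rewrite -(radical_ub a Pp) E radical_ub.
congr con_inf; apply/seteqP; split=> p /= [Pp H]; split=> //.
  by rewrite -E.
by rewrite E.
Qed.

End Radical.

Arguments comm {tau V A} a b.
Arguments Spec {tau V} A.
Arguments radical {tau V A} a.
Arguments semiprime {tau V} A.
Arguments Cset {tau V} A.

Section Quotient.
Variables (tau : signature) (A : algebra tau) (a : con A).

Definition quo_carrier := {S : set A | exists x, S = a x}.

Definition quo_pi (x : A) : quo_carrier := exist _ (a x : set A) (ex_intro _ x erefl).

Lemma quo_piP x y : quo_pi x = quo_pi y <-> a x y.
Proof.
split=> [[E]|axy]; first by rewrite E; apply: con_refl.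
apply: eq_exist; apply/funext => z; apply/propext.
by split; apply: con_trans => //; apply: con_sym.
Qed.

Lemma quo_pi_surj (u : quo_carrier) : exists x, quo_pi x = u.
Proof.
by case: u => S [x ES]; exists x; apply: eq_exist; rewrite ES.
Qed.

Definition quo_repr u := projT1 (cid (quo_pi_surj u)).

Lemma quo_reprK u : quo_pi (quo_repr u) = u.
Proof. exact: (projT2 (cid (quo_pi_surj u))). Qed.

Lemma quo_inhabited : inhabited quo_carrier.
Proof. by case: (carrier_inhabited A) => x; apply: inhabits (quo_pi x). Qed.

Definition quo_algebra := @Algebra tau quo_carrier
  (fun s u => quo_pi (interp A s (fun i => quo_repr (u i)))) quo_inhabited.

Lemma quo_pi_hom s (x : 'I_(arity s) -> A) :
  quo_pi (interp A s x) = interp quo_algebra s (fun i => quo_pi (x i)).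
Proof.
apply/quo_piP/con_compat => i; apply/quo_piP; by rewrite quo_reprK.
Qed.

Definition quo_hom : hom A quo_algebra :=
  @Hom tau A quo_algebra quo_pi quo_pi_hom.

End Quotient.

Lemma top_finitely_generated (tau : signature) (V : sdcm_variety tau)
  (A : member V) : finitely_generated (\top : con A).
Proof.
have [a0] := carrier_inhabited A.
pose R := range (fun s => (interp A s (fun=> a0), a0)).
exists R; first exact/finite_image/finite_finset.
apply: le_anti; rewrite lex1 andbT; apply/conleP => x y _.
have QV : V (quo_algebra (cg R)).
  exact: (variety_H (@quo_pi_surj _ _ (cg R)) (memberP A)
            (f := quo_hom (cg R))).
apply/quo_piP; apply: contrapT => neq.
apply: (sdcm_semidegenerate QV); first by exists (quo_pi _ x), (quo_pi _ y).
exists (quo_pi (cg R) a0) => s u Hu.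
have -> : u = fun=> quo_pi (cg R) a0 by apply/funext.
rewrite -(quo_pi_hom (cg R) (fun=> a0)); apply/quo_piP.
by apply: cg_sub; exists s.
Qed.

Lemma finite_generation (tau : signature) (A : algebra tau) (a b : con A)
    (R : set (A * A)) : finite_set R -> cg R <= a `|` b ->
  exists T : set (A * A),
    [/\ finite_set T, (forall x y, T (x, y) -> a x y) & cg R <= cg T `|` b].
Proof.
move=> Rfin /conleP Rab.
pose good x y := exists T : set (A * A),
  [/\ finite_set T, (forall x y, T (x, y) -> a x y) & (cg T `|` b) x y].
have cg_mono (T T' : set (A * A)) : T `<=` T' -> cg T `|` b <= cg T' `|` b.
  by move=> TT'; apply: leU2 => //; apply: cg_le => x y /TT'; apply: cg_sub.
have good_con : exists g : con A, forall x y, g x y = good x y.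
  unshelve eexists (@Congruence _ _ good _ _ _ _) => //.
  - by move=> x; exists set0; split=> //; apply: con_refl.
  - by move=> x y [T [? ? H]]; exists T; split=> //; apply: con_sym.
  - move=> y x z [T [Tf Ta H]] [T' [T'f T'a H']]; exists (T `|` T')%classic; split.
    + by rewrite finite_setU.
    + by move=> u v [/Ta|/T'a].
    + apply: (@con_trans _ _ _ y).
        by move: H; apply/conleP/cg_mono => ?; left.
      by move: H'; apply/conleP/cg_mono => ?; right.
  - move=> s x y H; have [T HT] := fin_all_exists H.
    exists (\bigcup_(i in setT) T i); split.
    + apply: bigcup_finite => [|i _]; first exact: finite_finset.
      by have [] := HT i.
    + by move=> u v [i _ Ti]; have [_ Ta _] := HT i; apply: Ta.
    + apply: con_compat => i; have [_ _] := HT i.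
      by apply/conleP/cg_mono => p Tp; exists i.
have [g gE] := good_con.
have /conleP abg : a `|` b <= g.
  rewrite leUx; apply/andP; split; apply/conleP => x y Hxy; rewrite gE.
    exists [set (x, y)]; split; first exact: finite_set1.
      by move=> u v [-> ->].
    have /conleP : cg [set (x, y)] <= cg [set (x, y)] `|` b by exact: leUl.
    by apply; apply: cg_sub.
  exists set0; split=> //.
  by move: Hxy; apply/conleP/leUr.
have Rgood p : exists T : set (A * A), R p ->
  [/\ finite_set T, (forall x y, T (x, y) -> a x y) & (cg T `|` b) p.1 p.2].
  case: (pselect (R p)) => [Rp|nRp]; last by exists set0.
  have : good p.1 p.2.
    by rewrite -gE; apply/abg/Rab/cg_sub; rewrite -surjective_pairing.
  by case=> T HT; exists T.
have [T HT] := choice Rgood.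
exists (\bigcup_(p in R) T p); split.
- by apply: bigcup_finite => // p /HT[].
- by move=> x y [p /HT[_ Ta _]]; apply: Ta.
- apply: cg_le => x y Rxy; have [_ _] := HT _ Rxy.
  by apply/conleP/cg_mono => q Tq; exists (x, y).
Qed.

Section Complemented.
Variables (d : Order.disp_t) (L : tbLatticeType d).

Definition complements (x y : L) := x `&` y = \bot /\ x `|` y = \top.

Definition complemented : set L := [set x | exists y, complements x y].

(* The lattice operations make the complemented elements a Boolean algebra;
   automatic in a distributive lattice, but Con(A) need not be distributive. *)
Record complemented_boolean : Prop := ComplementedBoolean {
  complementedI : forall x y,
    complemented x -> complemented y -> complemented (x `&` y);
  complementedU : forall x y,
    complemented x -> complemented y -> complemented (x `|` y);
  complemented_meetUl : forall x y z,
    complemented x -> complemented y -> complemented z ->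
    (x `|` y) `&` z = (x `&` z) `|` (y `&` z) }.

Lemma complements_sym x y : complements x y -> complements y x.
Proof. by case=> Hm Hj; split; rewrite 1?meetC 1?joinC. Qed.

Lemma complemented0 : complemented \bot.
Proof. by exists \top; split; [rewrite meet0x|rewrite join0x]. Qed.

Lemma complemented1 : complemented \top.
Proof. by exists \bot; split; [rewrite meetx0|rewrite joinx0]. Qed.

End Complemented.

Arguments complemented {d} L _.
Arguments complemented_boolean {d} L.

(* B(L), the Boolean algebra of complemented elements of L. *)
Definition Bool d (L : tbLatticeType d) (h : complemented_boolean L) : Type :=
  complemented L.

Fact Bool_display : Order.disp_t. Proof. exact: (Order.Disp tt tt). Qed.

Section BooleanAlgebra.
Variables (d : Order.disp_t) (L : tbLatticeType d) (h : complemented_boolean L).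
Local Notation B := (Bool h).
Implicit Types x y z : B.

HB.instance Definition _ := SubChoice.copy B (complemented L).

Lemma BoolP x : complemented L (val x).
Proof. exact: set_valP. Qed.

Definition mkBool (u : L) (Hu : complemented L u) : B := exist _ u (mem_set Hu).

Definition Bool_le x y := val x <= val y.
Definition Bool_meet x y := mkBool (complementedI h (BoolP x) (BoolP y)).
Definition Bool_join x y := mkBool (complementedU h (BoolP x) (BoolP y)).
Definition Bool_bot := mkBool (complemented0 L).
Definition Bool_top := mkBool (complemented1 L).
Definition Bool_compl x : B :=
  let c := cid (BoolP x) in
  mkBool (ex_intro _ (val x) (complements_sym (projT2 c))).

Lemma Bool_le_anti : antisymmetric Bool_le.
Proof. by move=> x y H; apply/val_inj/le_anti. Qed.

HB.instance Definition _ := Order.Le_isPOrder.Build Bool_display B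
  (fun x => lexx (val x)) Bool_le_anti (fun y x z => @le_trans _ _ _ _ _).

Lemma Bool_meetP x y z : (x <= Bool_meet y z) = (x <= y) && (x <= z).
Proof. exact: lexI. Qed.

Lemma Bool_joinP x y z : (Bool_join x y <= z) = (x <= z) && (y <= z).
Proof. exact: leUx. Qed.

HB.instance Definition _ :=
  Order.POrder_MeetJoin_isLattice.Build Bool_display B Bool_meetP Bool_joinP.

Lemma Bool_meetUl : left_distributive (@Order.meet _ B) (@Order.join _ B).
Proof.
by move=> x y z; apply: val_inj; apply: (complemented_meetUl h); apply: BoolP.
Qed.

HB.instance Definition _ :=
  Order.Lattice_Meet_isDistrLattice.Build Bool_display B Bool_meetUl.

Lemma Bool_bot_le x : Bool_bot <= x.
Proof. exact: le0x. Qed.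

Lemma Bool_top_le x : x <= Bool_top.
Proof. exact: lex1. Qed.

HB.instance Definition _ := Order.hasBottom.Build Bool_display B Bool_bot_le.
HB.instance Definition _ := Order.hasTop.Build Bool_display B Bool_top_le.

Lemma Bool_joinxC x : x `|` Bool_compl x = \top.
Proof. by apply: val_inj => /=; have [] := projT2 (cid (BoolP x)). Qed.

Lemma Bool_meetxC x : x `&` Bool_compl x = \bot.
Proof. by apply: val_inj => /=; have [] := projT2 (cid (BoolP x)). Qed.

HB.instance Definition _ := Order.TBDistrLattice_hasComplement.Build
  Bool_display B Bool_joinxC Bool_meetxC.

End BooleanAlgebra.

Lemma distr_complemented_boolean d (L : tbDistrLatticeType d) :
  complemented_boolean L.
Proof.
split=> [x y [x' [mx jx]] [y' [my jy]]|x y [x' [mx jx]] [y' [my jy]]|x y z _ _ _].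
- exists (x' `|` y'); split.
    by rewrite meetUr meetAC mx meet0x -meetA my meetx0 joinx0.
  by rewrite joinIl joinA jx join1x meet1x joinCA jy joinx1.
- exists (x' `&` y'); split.
    by rewrite meetUl meetA mx meet0x join0x meetCA my meetx0.
  by rewrite joinIr joinAC jx join1x -joinA jy joinx1 meetx1.
- exact: meetUl.
Qed.

Definition boolean_isomorphism d1 d2 (B1 : ctbDistrLatticeType d1)
    (B2 : ctbDistrLatticeType d2) (f : B1 -> B2) : Prop :=
  [/\ bijective f, f \bot = \bot & f \top = \top] /\
  [/\ {morph f : x y / x `|` y}, {morph f : x y / x `&` y}
    & {morph f : x / ~` x}].

Fact retic_display : Order.disp_t. Proof. exact: (Order.Disp tt tt). Qed.

Section Reticulation.
Variables (tau : signature) (V : sdcm_variety tau) (A : member V).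

Definition Ctype : Type := Cset A.
HB.instance Definition _ := SubChoice.copy Ctype (Cset A).

Lemma C_P (u : Ctype) : Cset A (val u).
Proof. exact: set_valP. Qed.

Definition mkC (a : con A) (Ha : Cset A a) : Ctype := exist _ a (mem_set Ha).

Lemma top_Cset : Cset A \top.
Proof. exact/Cset_fg/top_finitely_generated. Qed.

Lemma bot_Cset : Cset A \bot.
Proof.
apply: Cset_fg; exists set0 => //.
by apply: le_anti; rewrite le0x; apply: cg_le.
Qed.

Definition C_join (u v : Ctype) : Ctype := mkC (Cset_join (C_P u) (C_P v)).
Definition C_comm (u v : Ctype) : Ctype := mkC (Cset_comm (C_P u) (C_P v)).
Definition C_bot : Ctype := mkC bot_Cset.
Definition C_top : Ctype := mkC top_Cset.

Definition requiv (u v : Ctype) : bool := radical (val u) == radical (val v).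

Lemma requiv_equiv : equiv_class_of requiv.
Proof.
split=> [u|u v|v u w]; rewrite /requiv.
- exact: eqxx.
- exact: eq_sym.
- by move=> /eqP ->.
Qed.

Canonical requiv_rel := EquivRelPack requiv_equiv.

(* L(A): the quotient of C(A) identifying the elements with the same radical. *)
Definition Retic : Type := {eq_quot requiv_rel}%qT.
HB.instance Definition _ := Choice.on Retic.
HB.instance Definition _ := EqQuotient.on Retic.

Definition lam (u : Ctype) : Retic := \pi_Retic%qT u.

Lemma lamP u v :
  lam u = lam v <-> forall p, Spec A p -> (val u <= p) = (val v <= p).
Proof.
rewrite -radicalP; split=> [/eqP|E]; last by apply/eqP; rewrite eqmodE; apply/eqP.
by rewrite eqmodE => /eqP.
Qed.

Lemma lam_surj (x : Retic) : exists u, lam u = x.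
Proof. by exists (repr x); rewrite /lam reprK. Qed.

Definition Retic_join : Retic -> Retic -> Retic := lift_op2 Retic C_join.
Definition Retic_meet : Retic -> Retic -> Retic := lift_op2 Retic C_comm.

Lemma lam_repr u p : Spec A p -> (val (repr (lam u)) <= p) = (val u <= p).
Proof. by move: p; apply/lamP; rewrite /lam reprK. Qed.

Lemma lam_join u v : Retic_join (lam u) (lam v) = lam (C_join u v).
Proof.
unlock Retic_join; apply/lamP => p Pp.
by rewrite /= !leUx !lam_repr.
Qed.

Lemma lam_comm u v : Retic_meet (lam u) (lam v) = lam (C_comm u v).
Proof.
unlock Retic_meet; apply/lamP => p Pp.
by rewrite /= !prime_commE // !lam_repr.
Qed.

Lemma Retic_meetC : commutative Retic_meet.
Proof.
move=> x y; have [u <-] := lam_surj x; have [v <-] := lam_surj y.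
by rewrite !lam_comm; apply/lamP => p Pp; rewrite /= !prime_commE // orbC.
Qed.

Lemma Retic_joinC : commutative Retic_join.
Proof.
move=> x y; have [u <-] := lam_surj x; have [v <-] := lam_surj y.
by rewrite !lam_join; apply/lamP => p Pp; rewrite /= joinC.
Qed.

Lemma Retic_meetA : associative Retic_meet.
Proof.
move=> x y z; have [u <-] := lam_surj x; have [v <-] := lam_surj y.
have [w <-] := lam_surj z.
by rewrite !lam_comm; apply/lamP => p Pp; rewrite /= !prime_commE // orbA.
Qed.

Lemma Retic_joinA : associative Retic_join.
Proof.
move=> x y z; have [u <-] := lam_surj x; have [v <-] := lam_surj y.
have [w <-] := lam_surj z.
by rewrite !lam_join; apply/lamP => p Pp; rewrite /= joinA.
Qed.

Lemma Retic_joinKI y x : Retic_meet x (Retic_join x y) = x.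
Proof.
have [u <-] := lam_surj x; have [v <-] := lam_surj y.
rewrite lam_join lam_comm; apply/lamP => p Pp.
by rewrite /= prime_commE // leUx; do 2 case: (_ <= p).
Qed.

Lemma Retic_meetKU y x : Retic_join x (Retic_meet x y) = x.
Proof.
have [u <-] := lam_surj x; have [v <-] := lam_surj y.
rewrite lam_comm lam_join; apply/lamP => p Pp.
by rewrite /= leUx prime_commE //; do 2 case: (_ <= p).
Qed.

Lemma Retic_meetUl : left_distributive Retic_meet Retic_join.
Proof.
move=> x y z; have [u <-] := lam_surj x; have [v <-] := lam_surj y.
have [w <-] := lam_surj z.
rewrite !(lam_join, lam_comm); apply/lamP => p Pp.
by rewrite /= leUx !prime_commE // leUx orb_andl.
Qed.

Lemma Retic_meetxx : idempotent_op Retic_meet.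
Proof.
move=> x; have [u <-] := lam_surj x.
by rewrite lam_comm; apply/lamP => p Pp; rewrite /= prime_commE // orbb.
Qed.

HB.instance Definition _ :=
  Order.isMeetJoinDistrLattice.Build retic_display Retic
    (fun _ _ => erefl) (fun _ _ => erefl) Retic_meetC Retic_joinC
    Retic_meetA Retic_joinA Retic_joinKI Retic_meetKU Retic_meetUl Retic_meetxx.

Lemma lam_leP u v :
  lam u <= lam v <-> forall p, Spec A p -> val v <= p -> val u <= p.
Proof.
rewrite leEmeet; split=> [/eqP|H].
  rewrite -[_ `&` _]/(Retic_meet _ _) lam_comm => /lamP H p Pp vp.
  by rewrite -H //= prime_commE // vp orbT.
apply/eqP; rewrite -[_ `&` _]/(Retic_meet _ _) lam_comm; apply/lamP => p Pp.
by rewrite /= prime_commE //; apply/orb_idr/H.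
Qed.

Lemma Retic_bot_le x : lam C_bot <= x.
Proof.
by have [u <-] := lam_surj x; apply/lam_leP => p _ _; rewrite /= le0x.
Qed.

Lemma Retic_top_le x : x <= lam C_top.
Proof.
have [u <-] := lam_surj x; apply/lam_leP => p _ /= tp.
exact: le_trans (lex1 _) tp.
Qed.

HB.instance Definition _ :=
  Order.hasBottom.Build retic_display Retic Retic_bot_le.
HB.instance Definition _ :=
  Order.hasTop.Build retic_display Retic Retic_top_le.

Lemma complemented_Cset (a : con A) : complemented (con A) a -> Cset A a.
Proof.
case=> b [mab jab]; apply: Cset_fg.
have [R Rf ER] := top_finitely_generated A.
have [T [Tf Ta HT]] : exists T : set (A * A),
  [/\ finite_set T, (forall x y, T (x, y) -> a x y) & cg R <= cg T `|` b].
  by apply: finite_generation => //; rewrite jab lex1.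
have Tab : cg T `|` b = \top.
  by apply: le_anti; rewrite lex1 ER.
exists T => //.
have := sdcm_modular (memberP A) b (cg_le Ta).
by rewrite meetC mab joinx0 Tab meet1x.
Qed.

Lemma lam_complemented (a : con A) (Ha : complemented (con A) a) :
  complemented Retic (lam (mkC (complemented_Cset Ha))).
Proof.
case: (Ha) => b cab; have [mab jab] := cab.
have Hb : complemented (con A) b by exists a; apply: complements_sym.
exists (lam (mkC (complemented_Cset Hb))); split.
  rewrite -[_ `&` _]/(Retic_meet _ _) lam_comm; apply: le_anti.
  rewrite le0x andbT; apply/lam_leP => p Pp _ /=.
  by apply: le_trans (comm_le a b) _; rewrite mab le0x.
rewrite -[_ `|` _]/(Retic_join _ _) lam_join; apply: le_anti.
by rewrite lex1 /=; apply/lam_leP => p Pp /=; rewrite jab.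
Qed.

(* The restriction of lam to B(Con(A)), with values in B(L(A)). *)
Definition lamB (h : complemented_boolean (con A)) (x : Bool h) :
    Bool (distr_complemented_boolean Retic) :=
  mkBool _ (lam_complemented (BoolP x)).

End Reticulation.

Arguments Retic {tau V} A.
Arguments lam {tau V A} u.
Arguments lamB {tau V A} h x.

(* Main.v *)
(* The commutator [a, b] is bounded below by the Hagemann-Herrmann operation:
   let Delta be the congruence of the subalgebra a of A * A generated by the
   pairs ((u, u), (v, v)) with u b v, and relate x to y when (x, x) and (x, y)
   are congruent modulo Delta. By the shifting lemma, a form of the modular law,
   this is a congruence, symmetric in a and b, and it obeys the laws defining
   the commutator. For a = b = top the diagonal lies in one class of Delta, hence
   is a one-element subalgebra of A * A / Delta, so semidegeneracy forces
   Delta = top and [top, top] = top. Hence maximal congruences are prime, and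
   by Zorn's lemma every proper congruence lies below a prime.

   A prime contains x `&` y iff it contains x or y, because [x, y] <= x `&` y.
   When A is semiprime, x and y are thus complements iff every prime contains
   exactly one of them, and the modular law shows that a complemented congruence
   equals its radical; so complemented congruences are determined by the primes
   above them, exactly as the elements of the reticulation are. *)

Require Import Defs.
From mathcomp Require Import all_boot all_order.
From mathcomp Require Import boolp classical_sets functions cardinality.

Set Implicit Arguments.
Unset Strict Implicit.
Unset Printing Implicit Defensive.

Import Order.Theory.
Local Open Scope classical_set_scope.
Local Open Scope order_scope.

(** * Joins of congruences as chains *)

Section Generalities.
Variables (tau : signature) (A : algebra tau).
Implicit Types (a b c : con A).

Lemma join_left a b x y : a x y -> (a `|` b) x y.
Proof. exact/conleP/leUl. Qed.

Lemma join_right a b x y : b x y -> (a `|` b) x y.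
Proof. exact/conleP/leUr. Qed.

Lemma con_meetE a b x y : (a `&` b) x y <-> a x y /\ b x y.
Proof.
split=> [H|[ax bx]]; last by move=> d [] ->.
have {}H : con_meet a b x y by [].
by split; apply: H; [left|right].
Qed.

(** Joins are defined as intersections; finite zigzags through [a] and [b] describe them by
    elements. *)
Inductive chain a b (x : A) : A -> Prop :=
  | chain_refl : chain a b x x
  | chain_step y z : chain a b x y -> a y z \/ b y z -> chain a b x z.

Lemma chain_trans a b x y z : chain a b x y -> chain a b y z -> chain a b x z.
Proof. by move=> xy; elim=> // v w _ IH vw; apply: chain_step IH vw. Qed.

Lemma chain_sym a b x y : chain a b x y -> chain a b y x.
Proof.
elim=> [|v w _ IH vw]; first exact: chain_refl.
apply: chain_trans IH; apply: chain_step (chain_refl _ _ _) _.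
by case: vw => ?; [left|right]; apply: con_sym.
Qed.

(* The coordinates are changed one at a time. *)
Lemma chain_compat a b s (x y : 'I_(arity s) -> A) :
  (forall i, chain a b (x i) (y i)) ->
  chain a b (interp A s x) (interp A s y).
Proof.
move=> xy; pose z k (i : 'I_(arity s)) := if (i < k)%N then y i else x i.
have Hz k : chain a b (interp A s x) (interp A s (z k)).
  elim: k => [|k IH].
    have -> : z 0%N = x by apply/funext.
    exact: chain_refl.
  apply: chain_trans IH _; case: (ltnP k (arity s)) => [ks|sk]; last first.
    suff -> : z k.+1 = z k by exact: chain_refl.
    apply/funext => i; rewrite /z /=.
    have ik := leq_trans (ltn_ord i) sk.
    by rewrite ik (leqW ik).
  pose w u (i : 'I_(arity s)) := if i == Ordinal ks then u else z k i.
  have -> : z k = w (x (Ordinal ks)).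
    apply/funext => i; rewrite /w; case: eqP => [->|//].
    by rewrite /z /= ltnn.
  have -> : z k.+1 = w (y (Ordinal ks)).
    apply/funext => i; rewrite /w; case: eqP => [->|/eqP ne].
      by rewrite /z ltnS leqnn.
    rewrite /z /= ltnS leq_eqVlt.
    by have /negPf -> : nat_of_ord i != k by [].
  elim: (xy (Ordinal ks)) => [|v v' _ IH vv']; first exact: chain_refl.
  apply: chain_step IH _.
  by case: vv' => H; [left|right]; apply: con_compat => i; rewrite /w;
    case: eqP => // _; apply: con_refl.
have -> : y = z (arity s); last exact: Hz.
by apply/funext => i; rewrite /z /= ltn_ord.
Qed.

Lemma join_chain a b x y : (a `|` b) x y -> chain a b x y.
Proof.
pose g := Congruence (chain_refl a b) (@chain_sym a b)
  (fun y x z => @chain_trans a b x y z) (@chain_compat a b).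
suff /conleP H : a `|` b <= g by move=> /H.
rewrite leUx; apply/andP; split; apply/conleP => u v uv.
  by apply: chain_step (chain_refl _ _ _) _; left.
by apply: chain_step (chain_refl _ _ _) _; right.
Qed.

Lemma join_saturated a b (P : A -> Prop) :
  (forall x y, a x y -> P x -> P y) -> (forall x y, b x y -> P x -> P y) ->
  forall x y, (a `|` b) x y -> P x -> P y.
Proof.
move=> aP bP x y /join_chain; elim=> // v w _ IH [vw|vw] /IH.
  exact: aP vw.
exact: bP vw.
Qed.

End Generalities.

Section Transport.
Variables (tau : signature) (A B : algebra tau) (f : hom A B).

Lemma con_imgP (fS : surjective f) (a : con A) x y :
  con_img fS a (f x) (f y) <-> (a `|` con_ker f) x y.
Proof.
split=> [[x' [y' [Ex Ey H]]]|H]; last by exists x, y.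
apply: (@con_trans _ _ _ x'); first exact: join_right.
by apply: (con_trans H); apply: join_right.
Qed.

End Transport.

(** * The shifting lemma *)

Section Shifting.
Variables (tau : signature) (V : variety tau).
Hypothesis Vmod : congruence_modular V.

(** In the rectangle with [h]-sides [x y], [z w] and [v]-sides [x z], [y w], [g] moves from one
    [v]-side to the other. The pair [(y, w)] lies in the meet of [v] with the join of [h] and the
    meet of [v] and [g]; modularity rewrites this as a join of two meets, each below [g]. *)
Lemma shifting (A : algebra tau) (h v g : con A) x y z w : V A ->
  h `&` v <= g -> h x y -> h z w -> v x z -> g x z -> v y w -> g y w.
Proof.
move=> VA hvg hxy hzw vxz gxz vyw.
suff /conleP : (v `&` g `|` h) `&` v <= g.
  apply; apply/con_meetE; split=> //.
  apply: (@con_trans _ _ _ x); first by apply/join_right/con_sym.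
  apply: (@con_trans _ _ _ z); last exact: join_right.
  by apply/join_left/con_meetE.
by rewrite -(Vmod VA) ?leIl // leUx leIr hvg.
Qed.

End Shifting.

(** * The commutator in congruence-modular varieties *)

Section Blocks.
Variables (tau : signature) (A : algebra tau).
Implicit Types (a b : con A) (I J : Type).

(* The subalgebra of the power A^I made of the families lying in one a-class. *)
Definition in_block I a (x : I -> A) := forall i j, a (x i) (x j).

Definition block_carrier I a := {x : I -> A | in_block a x}.

Definition diag_fun I a (x : A) : block_carrier I a :=
  exist (in_block a) (fun=> x) (fun _ _ => con_refl a x).

Lemma block_inhabited I a : inhabited (block_carrier I a).
Proof. by case: (carrier_inhabited A) => x; exact: inhabits (diag_fun I a x). Qed.

Lemma block_closed I a s (u : 'I_(arity s) -> block_carrier I a) i j :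
  a (interp A s (fun k => sval (u k) i)) (interp A s (fun k => sval (u k) j)).
Proof. by apply: con_compat => k; apply: (svalP (u k)). Qed.

Definition block I a : algebra tau := @Algebra tau (block_carrier I a)
  (fun s u => exist (in_block a) (fun i => interp A s (fun k => sval (u k) i))
     (block_closed u)) (block_inhabited I a).

Lemma blockP I a (u : block I a) : in_block a (sval u).
Proof. exact: svalP. Qed.

Lemma block_ext I a (u v : block I a) : (forall i, sval u i = sval v i) -> u = v.
Proof.
by case: u v => u hu [v hv] /= uv; apply: eq_exist; apply/funext.
Qed.

Lemma block_variety (V : variety tau) I a : V A -> V (block I a).
Proof.
move=> VA; pose F (_ : I) := A.
have fP s (u : 'I_(arity s) -> block I a) :
  sval (interp (block I a) s u) = interp (prod_algebra F) s (fun i => sval (u i)).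
  by [].
apply: (variety_S (f := @Hom _ (block I a) (prod_algebra F) (fun u => sval u) fP)).
  by move=> u v /= E; apply: block_ext => i; rewrite E.
exact: variety_P.
Qed.

Definition proj I a (i : I) : hom (block I a) A :=
  @Hom _ (block I a) A (fun u => sval u i) (fun _ _ => erefl).

Definition diag I a : hom A (block I a).
Proof. by exists (@diag_fun I a) => s x; apply: block_ext. Defined.

Definition reindex I J a (g : J -> I) : hom (block I a) (block J a).
Proof.
exists (fun u => exist (in_block a) (fun j => sval u (g j))
                         (fun i j => blockP u (g i) (g j))) => s x.
exact: block_ext.
Defined.

Definition pair_fun T (x y : T) (i : bool) := if i then y else x.

Lemma pair_block a x y : a x y -> in_block a (pair_fun x y).
Proof.
by move=> xy [] [] //=; [apply: con_refl|apply: con_sym|apply: con_refl].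
Qed.

Definition pair a x y (xy : a x y) : block bool a :=
  exist (in_block a) _ (pair_block xy).

Lemma pair_eta a (u : block bool a) (H : a (sval u false) (sval u true)) :
  u = pair H.
Proof. by apply: block_ext => -[]. Qed.

Definition Delta a b : con (block bool a) :=
  cg [set p | exists x y, b x y /\ p = (diag bool a x, diag bool a y)].

(** The 2 by 2 matrix with rows [(x, y)] and [(u, v)]: rows lie in [a], columns in [b]. Quantifying
    over the membership proofs lets matrices be handled by their entries alone. *)
Definition dl a b x y u v :=
  exists (xy : a x y) (uv : a u v), Delta a b (pair xy) (pair uv).

Lemma DeltaE a b (u v : block bool a) :
  Delta a b u v <->
  dl a b (sval u false) (sval u true) (sval v false) (sval v true).
Proof.
split=> [uv|[hu [hv H]]]; last by rewrite (pair_eta hu) (pair_eta hv).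
exists (blockP u false true), (blockP v false true).
by rewrite -!pair_eta.
Qed.

Lemma Delta_le a b (g : con (block bool a)) :
  (forall x y, b x y -> g (diag bool a x) (diag bool a y)) -> Delta a b <= g.
Proof. by move=> H; apply: cg_le => _ _ [x [y [xy [-> ->]]]]; apply: H. Qed.

Lemma diag_pair a x : diag bool a x = pair (con_refl a x).
Proof. by apply: block_ext => -[]. Qed.

Lemma dl_diag a b x y : b x y -> dl a b x x y y.
Proof.
move=> xy; exists (con_refl a x), (con_refl a y).
by rewrite -!diag_pair; apply: cg_sub; exists x, y.
Qed.

Lemma dl_refl a b x y : a x y -> dl a b x y x y.
Proof. by move=> xy; exists xy, xy; apply: con_refl. Qed.

Lemma dl_sym a b x y u v : dl a b x y u v -> dl a b u v x y.
Proof. by move=> [h [k H]]; exists k, h; apply: con_sym. Qed.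

Lemma dl_trans a b u v x y z w :
  dl a b x y u v -> dl a b u v z w -> dl a b x y z w.
Proof.
move=> [h [k H]] [k' [l H']]; exists h, l; apply: con_trans H _.
by rewrite (Prop_irrelevance k k').
Qed.

Lemma dl_compat a b s (x y u v : 'I_(arity s) -> A) :
  (forall i, dl a b (x i) (y i) (u i) (v i)) ->
  dl a b (interp A s x) (interp A s y) (interp A s u) (interp A s v).
Proof.
move=> H.
have [h Hh] := fin_all_exists H; have [k Hk] := fin_all_exists Hh.
have := con_compat Hk; move/DeltaE => /=; exact.
Qed.

Lemma dl_base a b x y u v : dl a b x y u v -> b x u /\ b y v.
Proof.
move=> [xy [uv D]].
pose g := con_preim (proj a false) b `&` con_preim (proj a true) b.
have /conleP/(_ _ _ D)/con_meetE // : Delta a b <= g.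
by apply: Delta_le => z w zw; apply/con_meetE.
Qed.

Lemma dl_flip a b x y u v : dl a b x y u v -> dl a b y x v u.
Proof.
move=> [xy [uv D]].
have /conleP/(_ _ _ D)/DeltaE // :
  Delta a b <= con_preim (reindex a negb) (Delta a b).
by apply: Delta_le => z w zw; apply/DeltaE/dl_diag.
Qed.

(* The commutator of a and b in the sense of Hagemann and Herrmann. *)
Definition Cop a b : con A := cg [set p | dl a b p.1 p.1 p.1 p.2].

End Blocks.

Section ModularCommutator.
Variables (tau : signature) (V : variety tau).
Hypothesis Vmod : congruence_modular V.

Section OneAlgebra.
Variables (A : algebra tau).
Hypothesis VA : V A.
Implicit Types (a b e k : con A).

Lemma dl_class a b x y u v : dl a b x y u v -> a x y /\ a u v.
Proof. by case=> xy [uv _]. Qed.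

(** Shifting along the two coordinate kernels, whose meet is equality, replaces the common first
    entry of the rows. *)
Lemma dl_shift a b x y z w : dl a b x y x z -> a w x -> dl a b w y w z.
Proof.
move=> D wx; have [xy xz] := dl_class D; case: (D) => xy' [xz' Dxz].
have wy := con_trans wx xy; have wz := con_trans wx xz.
exists wy, wz.
apply: (shifting Vmod (h := con_ker (proj a true)) (v := con_ker (proj a false))
  (x := pair xy') (z := pair xz')) => //.
  exact: block_variety.
apply/conleP => u v /con_meetE[] /= E1 E0.
have -> : u = v by apply: block_ext => -[].
exact: (con_refl (Delta a b)).
Qed.

(** The generating relation is already a congruence: [dl_shift] moves the base point, which gives
    symmetry and transitivity. *)
Lemma CopE a b x y : Cop a b x y <-> dl a b x x x y.
Proof.
split; last by move=> D; apply: cg_sub.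
have gr z : dl a b z z z z by apply/dl_refl/con_refl.
have gs z w : dl a b z z z w -> dl a b w w w z.
  by move=> D; have [_ /con_sym wz] := dl_class D; apply/dl_sym/(dl_shift D).
have gt w z u : dl a b z z z w -> dl a b w w w u -> dl a b z z z u.
  move=> D D'; have [_ zw] := dl_class D.
  exact: dl_trans D (dl_shift D' zw).
have gc s (z w : 'I_(arity s) -> A) : (forall i, dl a b (z i) (z i) (z i) (w i)) ->
    dl a b (interp A s z) (interp A s z) (interp A s z) (interp A s w).
  exact: dl_compat.
suff /conleP : Cop a b <= Congruence gr gs gt gc by apply.
exact: cg_le.
Qed.

Lemma Cop_le a b : Cop a b <= a `&` b.
Proof.
apply/conleP => x y /CopE D; apply/con_meetE; split.
  by have [] := dl_class D.
by have [] := dl_base D.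
Qed.

(** Shifting on the rectangle [(p, p)], [(r, r)], [(p, q)], [(r, s)], with [Delta] across and
    equality of first coordinates down. *)
Lemma dl_saturated a b e p q r s :
  Cop a b <= e -> dl a b p q r s -> e p q -> e r s.
Proof.
move=> /conleP abe D epq; have [bpr _] := dl_base D.
case: (D) => pq [rs Dpq].
apply: (shifting Vmod (A := block bool a) (h := Delta a b)
  (v := con_ker (proj a false)) (g := con_preim (proj a true) e)
  (x := pair (con_refl a p)) (y := pair (con_refl a r))
  (z := pair pq) (w := pair rs)) => //; first exact: block_variety.
  (* Moving the common first coordinate onto the second coordinate of [u] yields a pair of
     [Cop a b]. *)
  apply/conleP => u v /con_meetE[/DeltaE Duv] /= E.
  apply/abe/CopE; apply: (dl_shift (x := sval u false)).
    by rewrite {2}E.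
  exact: blockP.
apply/DeltaE; exact: dl_diag.
Qed.

Definition block_cong k a : con (block bool a) :=
  con_preim (proj a false) k `&` con_preim (proj a true) k.

Lemma Delta_join_saturated a b e k (u v : block bool a) :
  Cop a b <= e -> k <= e -> (Delta a b `|` block_cong k a) u v ->
  e (sval u false) (sval u true) -> e (sval v false) (sval v true).
Proof.
move=> abe /conleP ke; move: u v.
apply: (join_saturated (A := block bool a)
  (P := fun u => e (sval u false) (sval u true))).
  by move=> u v /DeltaE; apply: dl_saturated.
move=> u v /con_meetE[/= /ke k0 /ke k1] e01.
by apply: con_trans (con_sym k0) (con_trans e01 k1).
Qed.

(** Matrices paste along a common column. Shifting is applied to triples: [h] fixes the outer
    coordinates, [v] is [Delta] on the first two, [g] is [Delta] on the last two, and the middle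
    entry is moved onto the first. *)
Lemma dl_vtrans a b u1 v1 u0 v0 u2 v2 :
  dl a b u0 u1 v0 v1 -> dl a b u1 u2 v1 v2 -> dl a b u0 u2 v0 v2.
Proof.
pose triple (x y z : A) (o : option bool) :=
  if o is Some i then pair_fun y z i else x.
have tripleP x y z : a x y -> a y z -> in_block a (triple x y z).
  move=> xy yz; have xz := con_trans xy yz.
  by case=> [[]|] [[]|] //=; first [exact: con_refl|exact: con_sym].
pose T := block (option bool) a.
pose i01 := pair_fun None (Some false).
pose i12 := pair_fun (Some false) (Some true).
move=> D01 D12.
have [u01 v01] := dl_class D01; have [u12 v12] := dl_class D12.
have bu := (dl_base D01).1.
pose P : T := exist (in_block a) _ (tripleP _ _ _ u01 u12).
pose Q : T := exist (in_block a) _ (tripleP _ _ _ v01 v12).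
pose P' : T := exist (in_block a) _
  (tripleP _ _ _ (con_refl a u0) (con_trans u01 u12)).
pose Q' : T := exist (in_block a) _
  (tripleP _ _ _ (con_refl a v0) (con_trans v01 v12)).
suff : con_preim (reindex a i12) (Delta a b) P' Q' by move/DeltaE.
apply: (shifting Vmod (A := T)
  (h := con_ker (proj a None) `&` con_ker (proj a (Some true)))
  (v := con_preim (reindex a i01) (Delta a b)) (x := P) (z := Q)).
- exact: block_variety.
- apply/conleP => S S' /con_meetE[/con_meetE[/= E0 E2] /DeltaE /= D].
  apply/DeltaE => /=; rewrite -E2; apply/dl_flip.
  apply: (dl_shift (x := sval S None)); last exact: blockP.
  by rewrite {2}E0.
- exact/con_meetE.
- exact/con_meetE.
- exact/DeltaE.
- exact/DeltaE.
- exact/DeltaE/dl_diag.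
Qed.

(** The transposes of [dl a b] matrices form a congruence, transitive by [dl_vtrans], that contains
    the generators of [Delta b a]; the matrix defining [Cop] is its own transpose. *)
Lemma Cop_sym_le a b : Cop b a <= Cop a b.
Proof.
apply/conleP => x y /CopE [xx [xy D]]; apply/CopE.
pose E (u v : block bool b) :=
  dl a b (sval u false) (sval v false) (sval u true) (sval v true).
have Er u : E u u by apply/dl_diag/blockP.
have Es u v : E u v -> E v u by apply: dl_flip.
have Et v u w : E u v -> E v w -> E u w by apply: dl_vtrans.
have Ec s (u v : 'I_(arity s) -> block bool b) : (forall i, E (u i) (v i)) ->
    E (interp _ s u) (interp _ s v) by apply: dl_compat.
have /conleP/(_ _ _ D) // : Delta b a <= Congruence Er Es Et Ec.
by apply: Delta_le => z w zw; apply: dl_refl.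
Qed.

Lemma Cop_sym a b : Cop a b = Cop b a.
Proof. by apply: le_anti; rewrite !Cop_sym_le. Qed.

(** Joining [k] to [b] enlarges [Delta] by at most [block_cong k a], and having a row in the join of
    [Cop a b] and [k] is invariant under both. *)
Lemma Cop_join_right a b k : Cop a (b `|` k) <= Cop a b `|` k.
Proof.
apply/conleP => x y /CopE [xx [xy D]].
have /conleP bk :
    b `|` k <= con_preim (diag bool a) (Delta a b `|` block_cong k a).
  rewrite leUx; apply/andP; split; apply/conleP => z w zw.
    by apply/join_left/DeltaE/dl_diag.
  by apply/join_right/con_meetE.
have /conleP H : Delta a (b `|` k) <= Delta a b `|` block_cong k a.
  by apply: Delta_le => z w /bk.
move: (H _ _ D) => /(Delta_join_saturated (leUl _ _) (leUr _ _)); apply.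
exact: con_refl.
Qed.

Lemma Cop_join_left a b k : Cop (a `|` k) b <= Cop a b `|` k.
Proof. by rewrite Cop_sym [Cop a b]Cop_sym; apply: Cop_join_right. Qed.

End OneAlgebra.

Section Morphisms.
Variables (A B : algebra tau) (f : hom A B).

Definition block_map I (a : con A) (c : con B) (ac : a <= con_preim f c) :
  hom (block I a) (block I c).
Proof.
exists (fun u => exist (in_block c) (fun i => f (sval u i))
  (fun i j => elimT (conleP _ _) ac _ _ (blockP u i j))) => s u.
by apply: block_ext => i /=; apply: homP.
Defined.

Lemma Cop_hom (a b : con A) (c d : con B) : V A ->
  a <= con_preim f c -> b <= con_preim f d ->
  Cop a b <= con_preim f (Cop c d).
Proof.
move=> VA ac /conleP bd; apply/conleP => x y /(CopE VA) [xx [xy D]].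
apply: cg_sub => /=.
have /conleP/(_ _ _ D)/DeltaE // :
  Delta a b <= con_preim (block_map bool ac) (Delta c d).
by apply: Delta_le => z w /bd zw; apply/DeltaE/dl_diag.
Qed.

Lemma le_preim_img (fS : surjective f) (a : con A) :
  a `|` con_ker f <= con_preim f (con_img fS a).
Proof. by apply/conleP => x y xy; apply/con_imgP. Qed.

Lemma Cop_preim_img (fS : surjective f) (a b : con A) : V A ->
  con_preim f (Cop (con_img fS a) (con_img fS b)) <=
  Cop (a `|` con_ker f) b `|` con_ker f.
Proof.
move=> VA; have VB := variety_H fS VA.
set a' := a `|` con_ker f; set e := _ `|` con_ker f.
have ke : forall x y, f x = f y -> e x y by move=> x y xy; apply: join_right.
pose F := block_map bool (le_preim_img fS a).
(* Surjectivity relies on working over [a'], which contains the kernel of [f]. *)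
have FS : surjective F.
  move=> u; have [x fx] := fS (sval u false); have [y fy] := fS (sval u true).
  have xy : a' x y by apply/con_imgP; rewrite fx fy; apply: blockP.
  by exists (pair xy); apply: block_ext => -[].
have /conleP bk :
    b `|` con_ker f <= con_preim (diag bool a') (Delta a' b `|` con_ker F).
  rewrite leUx; apply/andP; split; apply/conleP => x y xy.
    by apply/join_left/DeltaE/dl_diag.
  by apply: join_right; apply: block_ext.
have /conleP HD :
    Delta (con_img fS a) (con_img fS b) <= con_img FS (Delta a' b).
  apply: Delta_le => _ _ [x [y [<- <- /bk xy]]].
  by exists (diag bool a' x), (diag bool a' y); split=> //; apply: block_ext.
apply/conleP => x y /= /(CopE VB) [xx [xy D]].
have [u [v [Eu Ev uv]]] := HD _ _ D.
have fu i : f (sval u i) = pair_fun (f x) (f x) i.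
  by have := congr1 (fun w => sval w i) Eu.
have fv i : f (sval v i) = pair_fun (f x) (f y) i.
  by have := congr1 (fun w => sval w i) Ev.
(* The first row of the lifted matrix lies in the kernel, so saturation puts its second row in
   [e]. *)
have exy : e (sval v false) (sval v true).
  apply: (@Delta_join_saturated _ VA a' b e (con_ker f) u v); rewrite ?leUl ?leUr //.
    move: uv; apply/conleP/leU2 => //.
    apply/conleP => z w zw; apply/con_meetE.
    by split=> /=; [have := congr1 (fun t => sval t false) zw
                   |have := congr1 (fun t => sval t true) zw].
  by apply: ke; rewrite !fu.
apply: con_trans (con_trans _ exy) _; apply: ke; by rewrite fv.
Qed.

End Morphisms.

Lemma Cop_laws : commutator_laws V (@Cop tau).
Proof.
move=> A VA; split=> [|B f fS] a b; first exact: Cop_le.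
apply: le_anti; apply/andP; split.
  rewrite leUx ker_le_preim andbT; apply: Cop_hom => //.
    by apply: le_trans (le_preim_img fS a); apply: leUl.
  by apply: le_trans (le_preim_img fS b); apply: leUl.
(* The lift has put the kernel into the first argument; [Cop_join_left] takes it out again. *)
apply: le_trans (Cop_preim_img fS a b VA) _.
by rewrite leUx leUr Cop_join_left.
Qed.

End ModularCommutator.

(** * Prime congruences *)

Section MaximalCongruences.
Variables (tau : signature) (A : algebra tau).
Hypothesis top_fg : finitely_generated (\top : con A).
Implicit Types (c d m : con A) (F : set (con A)).

(** The member [m0] is the bound for the empty list. *)
Lemma total_finite_ub F m0 (I : eqType) (m : I -> con A) (s : seq I) : F m0 ->
  total_on F (fun c d => c <= d) -> (forall i, F (m i)) ->
  exists2 M, F M & forall i, i \in s -> m i <= M.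
Proof.
move=> Fm0 Ftot Fm; elim: s => [|i s [M FM IH]]; first by exists m0.
have [Mi|iM] := Ftot _ _ FM (Fm i).
  exists (m i) => // j; rewrite in_cons => /orP[/eqP -> //|/IH jM].
  exact: le_trans jM Mi.
by exists M => // j; rewrite in_cons => /orP[/eqP -> //|/IH].
Qed.

(** The union of a nonempty chain is a congruence because arities are finite. Were it [\top], one
    member would contain the finitely many generators of [\top]. *)
Lemma sup_proper F m0 : F m0 -> total_on F (fun c d => c <= d) ->
  (forall c, F c -> c <> \top) -> con_sup F <> \top.
Proof.
move=> Fm0 Ftot Fproper supT.
pose g x y := exists2 m, F m & m x y.
have gr x : g x x by exists m0 => //; apply: con_refl.
have gs x y : g x y -> g y x by move=> [m Fm xy]; exists m => //; apply: con_sym.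
have gt y x z : g x y -> g y z -> g x z.
  move=> [m Fm xy] [n Fn yz]; have [/conleP mn|/conleP nm] := Ftot _ _ Fm Fn.
    by exists n => //; apply: con_trans (mn _ _ xy) yz.
  by exists m => //; apply: con_trans xy (nm _ _ yz).
have gc s (x y : 'I_(arity s) -> A) : (forall i, g (x i) (y i)) ->
    g (interp A s x) (interp A s y).
  move=> xy; have xym i : exists m : con A, F m /\ m (x i) (y i).
    by have [m Fm mi] := xy i; exists m.
  have [m Hm] := choice xym.
  have [M FM MP] := total_finite_ub (enum 'I_(arity s)) Fm0 Ftot (fun i => (Hm i).1).
  exists M => //; apply: con_compat => i.
  have /conleP := MP i (mem_enum _ i); apply.
  by have [] := Hm i.
have /conleP supg : con_sup F <= Congruence gr gs gt gc.
  by apply: con_sup_le => m Fm; apply/conleP => x y mxy; exists m.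
have [R Rfin RT] := top_fg.
(* The type [{classic A * A}] equips pairs with the equality test that list membership needs. *)
have [s Rs] : exists s : seq {classic A * A}, (R : set {classic A * A}) = [set` s].
  exact/finite_seqP.
have pm (p : A * A) : exists m : con A, F m /\ m p.1 p.2.
  by have [|m Fm mp] := supg p.1 p.2; [rewrite supT|exists m].
have [m Hm] := choice pm.
have [M FM MP] := total_finite_ub (I := {classic A * A}) s Fm0 Ftot
  (fun p => (Hm p).1).
apply: (Fproper _ FM); apply: le_anti; rewrite lex1 RT; apply: cg_le => x y Rxy.
have /MP/conleP : ((x, y) : {classic A * A}) \in s.
  have : [set` s] (x, y) by rewrite -Rs.
  by [].
by apply; have [] := Hm (x, y).
Qed.

Lemma maximal_congruence c : c <> \top ->
  exists m, [/\ c <= m, m <> \top & forall d, m <= d -> d <> \top -> d = m].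
Proof.
move=> cT; pose P d := c <= d /\ d <> \top; pose T := {d | P d}.
have [//|?? ?|[x Hx] [y Hy] /= xy yx|F Ftot|[m [cm mT]] mmax] :=
    @Zorn T (fun x y => sval x <= sval y).
- exact: le_trans.
- by apply/eq_exist/le_anti; rewrite xy yx.
- have [F0|[x0 Fx0]] : (forall x, ~ F x) \/ exists x, F x.
    by have [|/forallNP] := pselect (exists x, F x); [right|left].
    (* The empty chain is bounded by [c] itself. *)
    by exists (exist P c (conj (lexx c) cT)) => x /F0.
  pose G := [set sval x | x in F].
  have Gtot : total_on G (fun c d => c <= d).
    by move=> _ _ [x Fx <-] [y Fy <-]; apply: Ftot.
  have Gsup x : F x -> sval x <= con_sup G.
    by move=> Fx; apply: con_sup_ub; exists x.
  have GT : con_sup G <> \top.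
    apply: (sup_proper (m0 := sval x0)) => //; first by exists x0.
    by move=> _ [x _ <-]; have [] := svalP x.
  have cG : c <= con_sup G by apply: le_trans (Gsup _ Fx0); have [] := svalP x0.
  by exists (exist P _ (conj cG GT)).
- exists m; split=> // d md dT.
  have cd := le_trans cm md.
  by have /(congr1 sval) := mmax (exist P d (conj cd dT)) md.
Qed.

End MaximalCongruences.

Section Semidegenerate.
Variables (tau : signature) (V : sdcm_variety tau).

(* The diagonal is a single Delta-class, hence a one-element subalgebra of the
   quotient of A * A by Delta. *)
Lemma Cop_top (A : algebra tau) : V A -> Cop (\top : con A) \top = \top.
Proof.
move=> VA; apply: le_anti; rewrite lex1; apply/conleP => x y _.
set D := Delta (\top : con A) \top.
have VQ : V (quo_algebra D).
  exact: (variety_H (@quo_pi_surj _ _ D) (block_variety _ _ VA)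
            (f := quo_hom D)).
have QT u v : D u v.
  apply/quo_piP; apply: contrapT => uv.
  apply: (sdcm_semidegenerate VQ); first by exists (quo_pi D u), (quo_pi D v).
  have [a0] := carrier_inhabited A.
  exists (quo_pi D (diag bool _ a0)) => s w wP.
  have -> : w = fun=> quo_pi D (diag bool _ a0) by apply/funext.
  rewrite -(quo_pi_hom D (fun=> diag bool _ a0)) -homP.
  by apply/quo_piP/DeltaE/dl_diag.
apply/(CopE (@sdcm_modular _ V) VA).
by move: (QT (pair (a := \top) (x := x) (y := x) I)
             (pair (a := \top) (x := x) (y := y) I)) => /DeltaE.
Qed.

Lemma commutator_top (A : algebra tau) : V A ->
  commutator V (\top : con A) \top = \top.
Proof.
move=> VA; apply: le_anti; rewrite lex1 -[X in X <= _](Cop_top VA).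
exact: (commutator_greatest V).2 (Cop_laws (@sdcm_modular _ V)) _ VA _ _.
Qed.

Variable A : member V.
Implicit Types (c x y p : con A).

(** If neither [a] nor [b] is below [m], both become [\top] in the quotient by [m], where the
    commutator of [\top] with itself is [\top]. Pulled back, the join of [m] and the commutator of
    [a] and [b] is [\top]; with that commutator below [m], this forces [m] to be [\top]. *)
Lemma maximal_prime m : m <> \top ->
  (forall d : con A, m <= d -> d <> \top -> d = m) -> Spec A m.
Proof.
move=> mT mmax; split=> // a b abm; apply: contrapT => /not_orP[am bm].
have joinT c : ~ c <= m -> c `|` m = \top.
  move=> cm; apply: contrapT => cmT; apply: cm.
  by rewrite -(mmax _ (leUr m c) cmT) leUl.
pose f := quo_hom m; pose fS : surjective f := @quo_pi_surj _ _ m.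
have kerf : con_ker f = m.
  apply: con_ext => x y; exact: quo_piP.
have imgT c : c `|` m = \top -> con_img fS c = \top.
  move=> cT; apply: le_anti; rewrite lex1; apply/conleP => u v _.
  have [x <-] := fS u; have [y <-] := fS v; apply/con_imgP.
  by rewrite kerf cT.
apply: mT; apply: le_anti; rewrite lex1.
have := (commutator_greatest V).1 A (memberP A); case=> _ /(_ _ f fS a b).
rewrite !imgT ?joinT // commutator_top; last exact: variety_H fS (memberP A).
rewrite kerf (join_r abm) => ->.
by apply/conleP.
Qed.

Lemma spec_cover c : (forall p, Spec A p -> ~~ (c <= p)) -> c = \top.
Proof.
move=> cP; apply: contrapT => cT.
have [m [cm mT mmax]] := maximal_congruence (top_finitely_generated A) cT.
by have := cP m (maximal_prime mT mmax); rewrite cm.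
Qed.

Lemma spec_top p : Spec A p -> (\top <= p) = false.
Proof. by case=> pT _; apply/negP => Tp; apply/pT/le_anti; rewrite lex1. Qed.

Lemma spec_meet p x y : Spec A p -> (x `&` y <= p) = (x <= p) || (y <= p).
Proof.
move=> Pp; apply/idP/idP => [H|/orP[] H].
- by rewrite -prime_commE //; apply: le_trans (comm_le x y) H.
- exact: le_trans (leIl _ _) H.
- exact: le_trans (leIr _ _) H.
Qed.

Lemma spec_complements p x y :
  Spec A p -> complements x y -> (y <= p) = ~~ (x <= p).
Proof.
move=> Pp [m j]; have := spec_meet x y Pp; have := leUx x y p.
by rewrite m j le0x spec_top //; case: (x <= p); case: (y <= p).
Qed.

(** * Complemented congruences of a semiprime algebra *)

Hypothesis hA : semiprime A.

Lemma semiprime_bot c : (forall p, Spec A p -> c <= p) -> c = \bot.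
Proof.
move=> cP; apply: le_anti; rewrite le0x andbT -hA; apply/conleP => x y cxy p [Pp _].
by have /conleP := cP p Pp; apply.
Qed.

Lemma complements_spec x y :
  (forall p, Spec A p -> (y <= p) = ~~ (x <= p)) -> complements x y.
Proof.
move=> H; split.
  by apply: semiprime_bot => p Pp; rewrite spec_meet // H // orbN.
by apply: spec_cover => p Pp; rewrite leUx H // andbN.
Qed.

(* If y is a complement of x, every prime contains y `&` radical x, which is
   therefore bottom, and the modular law gives radical x = x. *)
Lemma complemented_radical x : complemented (con A) x -> radical x = x.
Proof.
move=> [y xy]; have [_ j] := xy.
have xr : x <= radical x.
  by apply/conleP => u v xuv p [_ /conleP]; apply.
have ry : y `&` radical x = \bot.
  apply: semiprime_bot => p Pp.
  by rewrite spec_meet // radical_ub // (spec_complements Pp xy) orNb.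
by have := sdcm_modular (memberP A) y xr; rewrite ry j joinx0 meet1x.
Qed.

Lemma complemented_spec_inj x y :
  complemented (con A) x -> complemented (con A) y ->
  (forall p, Spec A p -> (x <= p) = (y <= p)) -> x = y.
Proof.
move=> /complemented_radical xr /complemented_radical yr /radicalP.
by rewrite xr yr.
Qed.

Lemma semiprime_complemented_boolean : complemented_boolean (con A).
Proof.
have hI x y : complemented (con A) x -> complemented (con A) y ->
    complemented (con A) (x `&` y).
  move=> [x' xx'] [y' yy']; exists (x' `|` y'); apply: complements_spec => p Pp.
  by rewrite spec_meet // leUx (spec_complements Pp xx') (spec_complements Pp yy')
    negb_or.
have hU x y : complemented (con A) x -> complemented (con A) y ->
    complemented (con A) (x `|` y).
  move=> [x' xx'] [y' yy']; exists (x' `&` y'); apply: complements_spec => p Pp.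
  by rewrite spec_meet // leUx (spec_complements Pp xx') (spec_complements Pp yy')
    negb_and.
(* Both sides of the distributive law are complemented, so comparing them at each prime suffices. *)
split=> // x y z Cx Cy Cz; apply: complemented_spec_inj => [||p Pp].
- by apply: hI => //; apply: hU.
- by apply: hU; apply: hI.
- by rewrite leUx !spec_meet // leUx orb_andl.
Qed.

End Semidegenerate.

(** * The Boolean isomorphism *)

Lemma compl_unique d (L : ctbDistrLatticeType d) (x y : L) :
  x `&` y = \bot -> x `|` y = \top -> y = ~` x.
Proof.
move=> m j; apply: le_anti; apply/andP; split.
  by rewrite -[y]meetx1 -(joinxC x) meetUr [y `&` x]meetC m join0x leIr.
by rewrite -[~` x]meetx1 -j meetUr meetCx join0x leIr.
Qed.

Lemma lamB_isomorphism (tau : signature) (V : sdcm_variety tau) (A : member V)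
    (hA : semiprime A) (h : complemented_boolean (con A)) :
  boolean_isomorphism (lamB h).
Proof.
have fI : injective (lamB h).
  move=> x y /(congr1 val) /lamP E; apply: val_inj.
  by apply: (complemented_spec_inj hA); [exact: BoolP|exact: BoolP|].
have fS y : exists x, lamB h x = y.
  (* Representatives [u] of [y] and [v] of a complement of [y] are themselves complements, since
     every prime contains exactly one of them. *)
  have [z [m j]] := BoolP y.
  have [u uy] := lam_surj (val y); have [v vz] := lam_surj z.
  rewrite -uy -vz in m j.
  have uv : complements (val u) (val v).
    apply: (complements_spec hA) => p Pp.
    move: m; rewrite -[_ `&` _]/(Retic_meet _ _) lam_comm => /lamP/(_ p Pp) /=.
    move: j; rewrite -[_ `|` _]/(Retic_join _ _) lam_join => /lamP/(_ p Pp) /=.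
    rewrite prime_commE // leUx le0x spec_top //.
    by case: (val u <= p); case: (val v <= p).
  exists (mkBool h (ex_intro _ _ uv)); apply: val_inj.
  by rewrite -uy; apply/lamP.
have f0 : lamB h \bot = \bot by apply: val_inj; apply/lamP.
have f1 : lamB h \top = \top by apply: val_inj; apply/lamP.
have fU : {morph lamB h : x y / x `|` y}.
  move=> x y; apply: val_inj.
  rewrite /= -[RHS]/(Retic_join _ _) lam_join; exact/lamP.
(* Meet and commutator lie below the same primes, hence have the same class. *)
have fM : {morph lamB h : x y / x `&` y}.
  move=> x y; apply: val_inj.
  rewrite /= -[RHS]/(Retic_meet _ _) lam_comm; apply/lamP => p Pp.
  by rewrite /= spec_meet // prime_commE.
split; split=> //.
  have [g gK] := choice fS; exists g => // x; exact: fI.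
by move=> x; apply: compl_unique; rewrite -?fM -?fU ?meetxC ?joinxC.
Qed.

Theorem proposition4p4 (tau : signature) (V : sdcm_variety tau) (A : member V)
    (hA : semiprime A) :
  exists h : complemented_boolean (con A), boolean_isomorphism (lamB h).
Proof.
by exists (semiprime_complemented_boolean hA); apply: lamB_isomorphism.
Qed.
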